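(* There exist Liouville numbers $\alpha\in(0,1)$ with the following property: for every $U\subset S^1$ which is a union of finitely many intervals with $m(U)=\tfrac12$, and for every $x\in S^1$, the series $$\sum_{n=1}^\infty \frac{f(x+n\alpha)}{n},\qquad f=2\chi_U-1,$$ converges. Moreover, the set of Liouville numbers $\alpha\in(0,1)$ with this property is dense in $(0,1)$.
   Context: $S^1=\mathbb{R}/\mathbb{Z}$, $m$ is Lebesgue measure on $S^1$ (normalized so $m(S^1)=1$), $\chi_U$ is the indicator function of $U$, and $x+n\alpha$ is taken mod $1$. An irrational real number $\alpha$ is a Liouville number if for every $v\ge 1$ there exists a rational number $\frac pq$ with integers $p,q$, $q\ge 2$, such that $\left|\alpha-\frac pq\right|<q^{-(v+1)}$. *)

(* Defs.v *)
From HB Require Import structures.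
From mathcomp Require Import all_boot all_order all_algebra.
From mathcomp Require Import generic_quotient ring_quotient.
From mathcomp Require Import all_classical all_reals all_analysis.

Set Implicit Arguments.
Unset Strict Implicit.
Unset Printing Implicit Defensive.

Import Order.TTheory GRing.Theory Num.Theory.
Import numFieldNormedType.Exports.

Local Open Scope classical_set_scope.
Local Open Scope ring_scope.

(* The predicate underlying Num.int. *)
Definition integers (R : realType) : zmodClosed R :=
  GRing.ZmodClosed.clone R (@Num.int_num_subdef R) _.

(* R / Z, with the zmodType structure induced from R. *)
Definition circle (R : realType) : zmodType := Quotient.quot (integers R).

Definition circle_proj {R : realType} (t : R) : circle R :=
  (\pi_(Quotient.quot (integers R)) t)%qT.

(* Normalized Lebesgue measure, computed on the fundamental domain [0, 1). *)
Definition circle_measure {R : realType} (U : set (circle R)) : \bar R :=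
  @lebesgue_measure R (`[0, 1[ `&` circle_proj @^-1` U).

(* Of any type (open, closed, half-open, possibly degenerate); an interval of R
   longer than 1 wraps around and gives the whole circle. *)
Definition circle_interval {R : realType} (I : set (circle R)) : Prop :=
  exists J : set R, is_interval J /\ I = circle_proj @` J.

Definition finite_union_of_intervals {R : realType} (U : set (circle R)) :
    Prop :=
  exists (k : nat) (I : 'I_k -> set (circle R)),
    (forall i, circle_interval (I i)) /\ U = \bigcup_i I i.

Definition liouville {R : realType} (alpha : R) : Prop :=
  irrational alpha /\
  forall v : R, 1 <= v -> exists p q : int,
    2 <= q /\ `|alpha - p%:~R / q%:~R| < q%:~R `^ (- (v + 1)).

Definition balanced {R : realType} (U : set (circle R)) (x : circle R) : R :=
  2 * \1_U x - 1.

Definition series_converges {R : realType} (alpha : R) (U : set (circle R))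
    (x : circle R) : Prop :=
  cvgn (fun N : nat =>
    \sum_(1 <= n < N.+1) balanced U (x + circle_proj (n%:R * alpha)) / n%:R).

Definition balanced_series_property {R : realType} (alpha : R) : Prop :=
  forall U : set (circle R), finite_union_of_intervals U ->
    circle_measure U = (2^-1)%:E ->
    forall x : circle R, series_converges alpha U x.

(* Main.v *)
Require Import Defs.
From mathcomp Require Import all_boot all_order all_algebra.
From mathcomp Require Import generic_quotient ring_quotient ring lra zify.
From mathcomp Require Import all_classical all_reals all_analysis.
Import Order.TTheory GRing.Theory Num.Theory.
Import numFieldNormedType.Exports.
Local Open Scope classical_set_scope.
Local Open Scope ring_scope.

(** Write S_N for the sum of f (x + n alpha) over 1 <= n <= N.  By summation by
    parts the series converges as soon as S_N = O(N / ln^2 N), so what is needed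
    is a Liouville number whose orbits equidistribute slightly better than
    trivially at every scale.  The numbers
      alpha = a / 2^m! + 2^-(m+1)! + 2^-(m+2)! + ...
    will do: the denominators Q_k = 2^k! of their good approximations grow fast
    enough for alpha to be a Liouville number, and yet slowly enough for
    ln^2 Q_(k+2) to be O(Q_k).

    The point is a Denjoy-Koksma estimate over one period Q = Q_k.  Since alpha
    exceeds P / Q by less than 1 / Q^2, with P coprime to Q, the points y + n alpha
    (n < Q) can be matched one to one with the windows [i/Q, (i+2)/Q) so that each
    point lies, modulo 1, in its window ([block_count]).  A union of k arcs has at
    most 2k end points, and each of them lies in at most two windows, so on all but
    4k windows the indicator of U is constant ([card_windows_split_by_union]);
    there, its value at the matched point equals Q times the measure of U in
    [i/Q, (i+1)/Q).  Summing over i, a block of Q consecutive terms of the sum of f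
    is at most 8k in absolute value, whatever the scale, the base point and the
    position of the block: this is where m(U) = 1/2 enters.

    For Q_(j+1) <= N < Q_(j+2), cutting {1, ..., N} into blocks of length Q_j gives
    |S_N| <= 8k N / Q_j + Q_j, and ln N <= (j+2)! is so small against
    Q_j = 2^j! that this is O(N / ln^2 N)
    ([partial_sum_bound_of_factorial_blocks]).  Density holds because the leading
    dyadic rational a / 2^m! is arbitrary
    ([factorially_approximable_in_cell]). *)

(** * The projection to the circle *)

Section Circle.
Context {R : realType}.
Implicit Types (s t : R) (U : set (circle R)).

Lemma circle_projD s t : circle_proj (s + t) = circle_proj s + circle_proj t.
Proof. exact: Quotient.pi_add. Qed.

Lemma circle_proj_eq s t :
  circle_proj s = circle_proj t <-> exists z : int, s = t + z%:~R.
Proof.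
split=> [/eqP|[z ->]].
  rewrite /circle_proj -Quotient.idealrBE => /intrP[z zE].
  by exists z; rewrite -zE addrC subrK.
apply/eqP; rewrite /circle_proj -Quotient.idealrBE addrC addKr.
exact: (@intr_int R).
Qed.

Lemma circle_proj_surj (x : circle R) : exists t, circle_proj t = x.
Proof. by exists (repr x)%qT; exact: reprK. Qed.

End Circle.

(** * Unions of arcs split few windows *)

Section Windows.
Context {R : realType}.
Implicit Types (V J : set R) (Q : nat).

(** Length 2/Q rather than 1/Q: the n-th orbit point is the point n P / Q of a
    rational rotation, itself off the grid, moved by a further amount below 1/Q,
    so only two consecutive grid cells together are sure to contain it. *)
Definition window Q (i : nat) : set R := `[i%:R / Q%:R, i.+2%:R / Q%:R[.

Definition splits V (W : set R) := exists s t, [/\ W s, W t, V s & ~ V t].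

Definition hit_windows Q (b : R) : {set 'I_Q} :=
  [set i : 'I_Q | `[< exists z : int, window Q i (b + z%:~R) >]]%SET.

Definition split_windows Q V : {set 'I_Q} :=
  [set i : 'I_Q | `[< splits V (window Q i) >]]%SET.

Lemma windowP Q i (t : R) : (0 < Q)%N ->
  window Q i t <-> i%:R <= Q%:R * t < i.+2%:R.
Proof.
move=> Q0; have Q0' : 0 < Q%:R :> R by rewrite ltr0n.
by rewrite /window /= in_itv /= ler_pdivrMr // ltr_pdivlMr // mulrC.
Qed.

(** Membership of b + z in the i-th window forces i to be floor (Q b) or
    floor (Q b) - 1 modulo Q, whatever the integer z. *)
Lemma card_windows_meeting_orbit Q (b : R) : (0 < Q)%N ->
  (#|hit_windows Q b| <= 2)%N.
Proof.
case: Q => // Q _; set h := Num.floor (Q.+1%:R * b).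
pose A : {set 'I_Q.+1} :=
  [set inord `|(h %% Q.+1)%Z|; inord `|((h - 1) %% Q.+1)%Z|]%SET.
suff sub : hit_windows Q.+1 b \subset A.
  apply: (leq_trans (subset_leq_card sub)); rewrite cards2.
  by case: (_ != _).
apply/fintype.subsetP => i; rewrite inE => /asboolP[z].
rewrite windowP // mulrDr => /andP[lo hi].
have ltiQ := ltn_ord i.
have /andP[hlo hhi] := floor_itv (Q.+1%:R * b); rewrite -/h in hlo hhi.
have Qz : Q.+1%:R * z%:~R = (Q.+1%:Z * z)%:~R :> R by rewrite intrM.
rewrite Qz in lo hi.
have lo' : (i%:Z < h + 1 + Q.+1%:Z * z)%R.
  rewrite -(ltr_int R) intrD; apply: le_lt_trans lo _.
  by rewrite ltrD2r.
have hi' : (h + Q.+1%:Z * z < i%:Z + 2)%R.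
  rewrite -(ltr_int R) !intrD -[i%:Z%:~R]/(i%:R : R).
  have -> : i%:R + 2%:~R = i.+2%:R :> R by rewrite -natrD addn2.
  by apply: le_lt_trans hi; rewrite lerD2r.
have small (w : int) : i%:Z = w + Q.+1%:Z * z -> `|(w %% Q.+1)%Z|%N = i.
  move=> e; have -> : w = - z * Q.+1%:Z + i%:Z by rewrite e; ring.
  by rewrite modzMDl modz_small //= ltz_nat ltiQ.
have [e|ne] := eqVneq (i%:Z) (h + Q.+1%:Z * z).
  by rewrite !inE (small _ e) inord_val eqxx.
have {}e : i%:Z = h - 1 + Q.+1%:Z * z by lia.
by rewrite !inE (small _ e) inord_val eqxx orbT.
Qed.

Lemma window_convex Q i : is_interval (window Q i).
Proof. exact: interval_is_interval. Qed.

(** A window containing a point inside J + z and one outside contains whatever lies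
    between them, and this includes the end point of J + z on that side.  Only the
    end on the side of the outer point need exist; an infinite end, for which sup
    or inf takes a junk value, is never the one that is used. *)
Lemma splits_translate_endpoint J (W : set R) (z : R) :
    is_interval J -> is_interval W ->
    splits [set t | J (t - z)] W ->
  W (sup J + z) \/ W (inf J + z).
Proof.
move=> iJ iW [s [t [Ws Wt Js Jt]]]; rewrite /= in Js Jt.
have [st|ts] := leP s t.
- left; have ub : ubound J (t - z).
    move=> y Jy; rewrite leNgt; apply/negP => lty; apply: Jt.
    by apply: (iJ _ _ Js Jy); rewrite lerD2r st ltW.
  apply: (iW _ _ Ws Wt); apply/andP; split.
    by rewrite -lerBlDr; apply: ub_le_sup => //; exists (t - z).
  by rewrite -lerBrDr; apply: ge_sup => //; exists (s - z).
- right; have lb : lbound J (t - z).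
    move=> y Jy; rewrite leNgt; apply/negP => lty; apply: Jt.
    by apply: (iJ _ _ Jy Js); rewrite lerD2r !ltW.
  apply: (iW _ _ Wt Ws); apply/andP; split.
    by rewrite -lerBlDr; apply: lb_le_inf => //; exists (s - z).
  by rewrite -lerBrDr; apply: ge_inf => //; exists (t - z).
Qed.

(** Lifting to the real line makes wrap-around harmless: an arc becomes the union
    of all integer translates of one interval, even when these overlap. *)
Lemma preimage_circle_interval J :
  circle_proj @^-1` (circle_proj @` J) =
  \bigcup_(z : int) [set t | J (t - z%:~R)].
Proof.
apply/seteqP; split=> t /=.
  move=> [s Js] /esym/circle_proj_eq[z ->]; exists z => //=.
  by rewrite addrK.
move=> [z _ /= Jtz]; exists (t - z%:~R) => //.
by apply/esym/circle_proj_eq; exists z; rewrite subrK.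
Qed.

Lemma measurable_preimage_circle_interval (I : set (circle R)) :
  circle_interval I -> measurable (circle_proj @^-1` I).
Proof.
move=> [J [iJ ->]]; rewrite preimage_circle_interval.
apply: countable_bigcupT_measurable => [|z]; first exact: countableP.
apply: measurable_realfun.is_interval_measurable.
move=> a b Ja Jb c /andP[ac cb]; apply: (iJ _ _ Ja Jb).
by rewrite !lerD2r ac.
Qed.

(** The end points of all translates of J form two orbits under integer
    translation, and each orbit meets at most two windows. *)
Lemma card_windows_split_by_interval Q (I : set (circle R)) :
    (0 < Q)%N -> circle_interval I ->
  (#|split_windows Q (circle_proj @^-1` I)| <= 4)%N.
Proof.
move=> Q0 [J [iJ ->]]; rewrite preimage_circle_interval.
suff sub : split_windows Q (\bigcup_(z : int) [set t | J (t - z%:~R)])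
    \subset hit_windows Q (sup J) :|: hit_windows Q (inf J).
  apply: (leq_trans (subset_leq_card sub)).
  apply: (leq_trans (leq_card_setU _ _)).
  by rewrite -[4%N]/(2 + 2)%N leq_add // card_windows_meeting_orbit.
apply/fintype.subsetP => i; rewrite inE => /asboolP[s [t [Ws Wt [z _ /= Jsz] nt]]].
have : splits [set u | J (u - z%:~R)] (window Q i).
  by exists s, t; split=> // Jtz; apply: nt; exists z.
move=> /(splits_translate_endpoint _ _ _ iJ (window_convex Q i)).
by case=> W; rewrite !inE; apply/orP; [left|right]; apply/asboolP; exists z.
Qed.

Lemma card_windows_split_by_union Q k (I : 'I_k -> set (circle R)) :
    (0 < Q)%N -> (forall j, circle_interval (I j)) ->
  (#|split_windows Q (circle_proj @^-1` (\bigcup_j I j))| <= 4 * k)%N.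
Proof.
move=> Q0 iI.
pose S j := split_windows Q (circle_proj @^-1` I j).
suff sub : split_windows Q (circle_proj @^-1` (\bigcup_j I j))
    \subset (\bigcup_j S j)%SET.
  apply: (leq_trans (subset_leq_card sub)).
  apply: (@leq_trans (\sum_(j < k) 4)); last first.
    by rewrite sum_nat_const card_ord mulnC.
  apply: (@leq_trans (\sum_(j < k) #|S j|)); last first.
    by apply: leq_sum => j _; apply: card_windows_split_by_interval.
  elim/big_rec2: _ => [|j n A _ IH]; first by rewrite cards0.
  by apply: leq_trans (leq_card_setU _ _) _; rewrite leq_add2l.
apply/fintype.subsetP => i; rewrite inE => /asboolP[s [t [Ws Wt [j _ Ij] nt]]].
apply/finset.bigcupP; exists j => //; rewrite inE; apply/asboolP.
by exists s, t; split=> // Ijt; apply: nt; exists j.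
Qed.

End Windows.

(** * Visits of an orbit block to a periodic set *)

Section BlockCount.
Context {R : realType}.
Implicit Types (V : set R) (Q : nat).

Definition cell Q (i : nat) : set R := `[i%:R / Q%:R, i.+1%:R / Q%:R[.

(** The proportion of the cell that is covered by V, as a cell has length 1/Q. *)
Definition cell_mass Q V (i : nat) : R :=
  Q%:R * fine (lebesgue_measure (cell Q i `&` V)).

Lemma measure_cell Q i : (0 < Q)%N ->
  lebesgue_measure (cell Q i) = (Q%:R^-1)%:E :> \bar R.
Proof.
move=> Q0; have Q0' : 0 < Q%:R^-1 :> R by rewrite invr_gt0 ltr0n.
rewrite /cell lebesgue_measure_itv /= lte_fin ltr_pM2r // ltr_nat ltnSn.
by rewrite -EFinD -mulrBl -natrB // subSnn mul1r.
Qed.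

Lemma measure_cellI Q V i : (0 < Q)%N -> measurable V ->
  (lebesgue_measure (cell Q i `&` V) <= (Q%:R^-1)%:E)%E.
Proof.
move=> Q0 mV; rewrite -(measure_cell Q i) //; apply: le_measure.
- by rewrite inE; apply: measurableI => //; exact: measurable_itv.
- by rewrite inE; exact: measurable_itv.
- exact: subIsetl.
Qed.

Lemma measure_cellI_fin Q V i : (0 < Q)%N -> measurable V ->
  lebesgue_measure (cell Q i `&` V) \is a fin_num.
Proof.
move=> Q0 mV; rewrite ge0_fin_numE //.
exact: le_lt_trans (measure_cellI _ _ i Q0 mV) (ltry _).
Qed.

Lemma cell_mass_ge0 Q V i : 0 <= cell_mass Q V i.
Proof. by rewrite mulr_ge0 // fine_ge0. Qed.

Lemma cell_mass_le1 Q V i : (0 < Q)%N -> measurable V -> cell_mass Q V i <= 1.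
Proof.
move=> Q0 mV; have Q0' : 0 < Q%:R :> R by rewrite ltr0n.
rewrite /cell_mass mulrC -ler_pdivlMr // div1r -lee_fin fineK ?measure_cellI_fin //.
exact: measure_cellI.
Qed.

Lemma cell_sub_window Q i : cell Q i `<=` window Q i.
Proof.
move=> t; rewrite /cell /window /= !in_itv /= => /andP[-> ti] /=.
by apply: lt_le_trans ti _; rewrite ler_wpM2r ?invr_ge0 ?ler_nat.
Qed.

(** If V does not split the window, the indicator is constant on it, hence on its
    left half, and equals the covered proportion; otherwise both numbers are in
    [0, 1]. *)
Lemma indicator_near_cell_mass Q V (i : 'I_Q) t :
    measurable V -> window Q i t ->
  `|\1_V t - cell_mass Q V i| <= (i \in split_windows Q V)%:R.
Proof.
move=> mV Wt; have Q0 : (0 < Q)%N by case: Q i Wt => // -[].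
have m0 := cell_mass_ge0 Q V i; have m1 := cell_mass_le1 Q V i Q0 mV.
rewrite indicE inE; case: asboolP => [sp|nsp].
  by rewrite ler_norml; case: (t \in V) => /=; apply/andP; split; lra.
have Q0' : Q%:R != 0 :> R by rewrite pnatr_eq0 -lt0n.
rewrite normr_le0 subr_eq0; apply/eqP; rewrite /cell_mass.
case: (boolP (t \in V)) => [/set_mem Vt|/negP nVt].
  rewrite setIidl ?measure_cell //= ?divff // => s /cell_sub_window Ws.
  by apply: contrapT => nVs; apply: nsp; exists t, s.
rewrite (_ : _ `&` _ = set0) ?measure0 ?mulr0 //.
rewrite -subset0 => s [/cell_sub_window Ws Vs]; apply: nsp; exists s, t.
by split=> // /mem_set.
Qed.

Lemma sum_cell_mass Q V : (0 < Q)%N -> measurable V ->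
  \sum_(i < Q) cell_mass Q V i =
  Q%:R * fine (lebesgue_measure (`[0, 1[ `&` V)).
Proof.
move=> Q0 mV; rewrite -mulr_sumr; congr (_ * _).
have Q0' : 0 < Q%:R :> R by rewrite ltr0n.
have partE n : (n <= Q)%N ->
    (\sum_(i < n) lebesgue_measure (cell Q i `&` V) =
     lebesgue_measure (`[0%R, (n%:R / Q%:R)%R[ `&` V))%E.
  elim: n => [|n IH] nQ; first by rewrite big_ord0 mul0r set_itvco0 set0I measure0.
  rewrite big_ord_recr /= IH; last exact: ltnW.
  rewrite -measureU; last 3 first.
  - by apply: measurableI => //; exact: measurable_itv.
  - by apply: measurableI => //; exact: measurable_itv.
  - rewrite -subset0 => t [[]]; rewrite /cell /= !in_itv /=.
    by move=> /andP[_ tn] _ [] /andP[nt] _; rewrite ltNge nt in tn.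
  rewrite -setIUl /cell; congr (lebesgue_measure (_ `&` _)).
  apply/seteqP; split=> t /=; rewrite !in_itv /=.
    case=> /andP[t0 tn]; apply/andP; split=> //.
      by apply: lt_trans tn _; rewrite ltr_pM2r ?invr_gt0 // ltr_nat.
    by apply: le_trans t0; rewrite divr_ge0.
  move=> /andP[t0 tn]; have [lt|ge] := ltP t (n%:R / Q%:R); [left|right].
    by rewrite t0.
  by rewrite tn.
have := partE Q (leqnn Q); rewrite divff ?gt_eqF // => <-.
rewrite [in RHS](eq_bigr (fun i : 'I_Q =>
  (fine (lebesgue_measure (cell Q i `&` V)))%:E)); first by rewrite sumEFin.
by move=> i _; rewrite fineK // measure_cellI_fin.
Qed.

(** A Denjoy-Koksma inequality for indicators.  Modulo 1, the n-th point lies in the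
    window of index floor (Q y) + n P modulo Q: the fractional part of Q y and the
    drift n (Q alpha - P) are both below 1.  As P is coprime to Q, this index runs
    once through all residues, so orbit points and cells can be compared one to
    one. *)
Lemma block_count Q V (P : int) (alpha y : R) :
    (0 < Q)%N -> measurable V -> (forall t (z : int), V (t + z%:~R) -> V t) ->
    coprimez Q P ->
    P%:~R <= Q%:R * alpha -> Q%:R * (Q%:R * alpha - P%:~R) < 1 ->
  `|\sum_(n < Q) \1_V (y + n%:R * alpha)
    - Q%:R * fine (lebesgue_measure (`[0, 1[ `&` V))|
  <= #|split_windows Q V|%:R.
Proof.
case: Q => // Q _ mV pV cP Pa aP.
have pV' t (z : int) : \1_V (t + z%:~R) = \1_V t :> R.
  rewrite !indicE; congr (_%:R); congr nat_of_bool; apply/idP/idP.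
    by move=> /set_mem /pV /mem_set.
  move=> /set_mem Vt; apply/mem_set; apply: (pV _ (- z)).
  by rewrite intrN addrK.
set h := Num.floor (Q.+1%:R * y).
pose idx (n : 'I_Q.+1) : 'I_Q.+1 := inord `|((h + n%:Z * P) %% Q.+1)%Z|.
have idxE n : (idx n)%:Z = ((h + n%:Z * P) %% Q.+1)%Z.
  rewrite /idx inordK; first by rewrite gez0_abs // modz_ge0.
  by rewrite -ltz_nat gez0_abs ?modz_ge0 // ltz_pmod.
have idx_inj : injective idx.
  move=> n m enm; apply/val_inj.
  have : ((h + n%:Z * P) == (h + m%:Z * P) %[mod Q.+1])%Z.
    by rewrite -!idxE enm.
  rewrite eqz_modDl eqz_mod_dvd -mulrBl Gauss_dvdzl // -eqz_mod_dvd.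
  by rewrite !modz_small ?ltz_nat ?ltn_ord //= eqz_nat => /eqP.
rewrite -sum_cell_mass // [X in _ - X](reindex_inj idx_inj) -sumrB.
apply: le_trans (ler_norm_sum _ _ _) _.
rewrite -sum1_card natr_sum [leRHS]big_mkcond [leRHS](reindex_inj idx_inj) /=.
apply: ler_sum => n _.
apply: (@le_trans _ _ (idx n \in split_windows Q.+1 V)%:R); last first.
  by case: (_ \in _).
set z := ((h + n%:Z * P) %/ Q.+1)%Z.
rewrite -(pV' _ (- z)); apply: indicator_near_cell_mass => //.
apply/windowP => //.
have eh : (h + n%:Z * P)%:~R = Q.+1%:R * z%:~R + (idx n)%:R :> R.
  rewrite {1}(divz_eq (h + n%:Z * P) Q.+1) -idxE -/z intrD intrM mulrC.
  by [].
rewrite intrD intrM in eh.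
have /andP[] := floor_itv (Q.+1%:R * y); rewrite -/h intrD.
have -> : (idx n).+2%:R = (idx n)%:R + 2 :> R by rewrite -addn2 natrD.
have nQ : n%:R <= Q.+1%:R :> R by rewrite ler_nat ltnW.
have n0 : 0 <= n%:R :> R by [].
rewrite -[n%:Z%:~R]/(n%:R : R) intrN in eh *.
move: (n%:R : R) (Q.+1%:R : R) (P%:~R : R) (h%:~R : R) (z%:~R : R)
  ((idx n)%:R : R) => u q p f w i in Pa aP eh nQ n0 * => fy yf.
have up : u * p <= u * (q * alpha) by rewrite ler_wpM2l.
have uq : u * (q * alpha - p) <= q * (q * alpha - p).
  by rewrite ler_wpM2r // subr_ge0.
by apply/andP; split; nra.
Qed.

End BlockCount.

(** * A convergence criterion for harmonically weighted series *)

Section Summation.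
Context {R : realType}.
Implicit Types (a : nat -> R) (C : R).

Lemma summation_by_parts a N :
  series (fun i => a i / i.+1%:R) N =
  series a N / N.+1%:R +
  series (fun i => series a i.+1 / (i.+1%:R * i.+2%:R)) N.
Proof.
elim: N => [|N IH]; first by rewrite /series /= !big_geq // mul0r addr0.
rewrite [LHS]seriesSr IH [X in _ = _ + X]seriesSr [series a N.+1]seriesSr.
have h1 : N.+1%:R != 0 :> R by rewrite pnatr_eq0.
have h2 : N.+2%:R != 0 :> R by rewrite pnatr_eq0.
have e2 : N.+2%:R = N.+1%:R + 1 :> R by rewrite -natr1.
rewrite e2 in h2 *; move: (N.+1%:R : R) h1 h2 => x h1 h2.
by field; rewrite h1 h2.
Qed.

(** The mean value inequality for 1 / ln, from ln (x + 1) - ln x >= 1 / (x + 1).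
    The factor 2 absorbs the difference between i + 2 and i + 3. *)
Lemma inv_ln_telescope (i : nat) :
  (i.+2%:R * ln (i.+3%:R) ^+ 2)^-1 <=
  2 * ((ln (i.+2%:R : R))^-1 - (ln (i.+3%:R))^-1).
Proof.
have i2 : 2 <= i.+2%:R :> R by rewrite ler_nat.
have e3 : i.+3%:R = i.+2%:R + 1 :> R by rewrite -natr1.
rewrite e3; move: (i.+2%:R : R) i2 => x x2.
have l0 : 0 < ln x by apply: ln_gt0; lra.
have x0 : 0 < x + 1 by lra.
have lle : (x + 1)^-1 <= ln (x + 1) - ln x.
  rewrite -lerN2 opprB -ln_div ?posrE //; last by lra.
  have -> : x / (x + 1) = 1 + - (x + 1)^-1 by field; rewrite gt_eqF.
  apply: le_ln1Dx; rewrite ltrN2 invf_lt1 //; lra.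
move: lle l0; move: (ln x) (ln (x + 1)) => l m lle l0.
have xi : 0 < (x + 1)^-1 by rewrite invr_gt0.
have lm : l < m by lra.
have m0 : 0 < m by lra.
have -> : l^-1 - m^-1 = (m - l) / (l * m) by field; rewrite !gt_eqF.
apply: (@le_trans _ _ (2 * ((x + 1)^-1 / (m * m)))); last first.
  rewrite ler_pM2l //; apply: ler_pM => //.
  - exact: ltW.
  - by rewrite invr_ge0 mulr_ge0 // ltW.
  - by rewrite lef_pV2 ?posrE ?mulr_gt0 // ler_pM2r // ltW.
rewrite invfM expr2 mulrA ler_pM2r ?invr_gt0 ?mulr_gt0 //.
rewrite -[leLHS]mul1r ler_pdivrMr; last by lra.
by rewrite mulrAC ler_pdivlMr //; lra.
Qed.

(** Summation by parts turns the series into a boundary term, at most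
    C / ln^2 N, plus a series dominated by a constant times the sum of
    1 / (n ln^2 n), which converges by telescoping 1 / ln n. *)
Lemma cvg_series_of_partial_sum_bound a C :
    (forall N, `|series a N| <= C * N%:R / ln (N.+2%:R) ^+ 2) ->
  cvgn (series (fun i => a i / i.+1%:R)).
Proof.
move=> aC.
have ln_pos n : 0 < ln (n.+2%:R : R) by apply: ln_gt0; rewrite ltr1n.
have C0 : 0 <= C.
  have := le_trans (normr_ge0 _) (aC 1%N).
  by rewrite mulr1 pmulr_lge0 // invr_gt0 exprn_gt0.
rewrite (funext (summation_by_parts a)).
apply: is_cvgD.
- apply: (@cvgP _ _ 0); apply/cvgr0Pnorm_le => e e0.
  pose B := Num.max 1 (C / e).
  have B1 : 1 <= B by rewrite le_max lexx.
  have BC : C / e <= B by rewrite le_max lexx orbT.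
  exists (Num.truncn (expR B)) => //= N /= hN.
  have hB : expR B < N.+2%:R.
    apply: lt_le_trans (truncnS_gt _) _.
    by rewrite ler_nat; apply: leq_trans hN _.
  have BL : B <= ln (N.+2%:R).
    by rewrite -[leLHS]expRK ler_ln ?posrE ?expR_gt0 // ltW.
  rewrite normrM normfV [X in _ / X]ger0_norm //.
  rewrite ler_pdivrMr ?ltr0n //; apply: le_trans (aC N) _.
  rewrite mulrAC; apply: ler_pM => //; last by rewrite ler_nat.
    by rewrite divr_ge0 // exprn_ge0 // ltW.
  rewrite ler_pdivrMr ?exprn_gt0 // -ler_pdivrMl // mulrC.
  apply: (le_trans BC); apply: (le_trans BL).
  by rewrite expr2 ler_peMl //; [rewrite ltW | apply: le_trans BL].
- apply: normed_cvg; apply: nondecreasing_is_cvgn.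
    apply/nondecreasing_seqP => n.
    by rewrite [leRHS]seriesSr lerDl /=.
  exists (2 * C / ln 2) => _ [N _ <-].
  suff : [normed series (fun i => series a i.+1 / (i.+1%:R * i.+2%:R))] N <=
      2 * C * ((ln 2)^-1 - (ln (N.+2%:R))^-1).
    move=> /le_trans; apply.
    by rewrite ler_wpM2l ?mulr_ge0 // lerBlDr lerDl invr_ge0 ltW.
  elim: N => [|N IH].
    by rewrite [leLHS]big_geq // subrr mulr0.
  rewrite [leLHS]seriesSr.
  have -> : (ln 2)^-1 - (ln N.+3%:R)^-1 =
    ((ln 2)^-1 - (ln N.+2%:R)^-1) + ((ln N.+2%:R)^-1 - (ln N.+3%:R)^-1) :> R.
    by ring.
  rewrite mulrDr; apply: lerD; first exact: IH.
  rewrite /= normrM normfV [X in _ / X]ger0_norm ?mulr_ge0 //.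
  rewrite ler_pdivrMr ?mulr_gt0 ?ltr0n //; apply: le_trans (aC N.+1) _.
  rewrite (mulrC 2) -!mulrA; apply: ler_wpM2l => //.
  have n12 : 0 <= N.+1%:R * N.+2%:R :> R by rewrite mulr_ge0.
  have L0 := ln_pos N.+1.
  have -> : N.+1%:R / ln N.+3%:R ^+ 2 =
    N.+1%:R * N.+2%:R * (N.+2%:R * ln N.+3%:R ^+ 2)^-1 :> R.
    by field; rewrite gt_eqF //= -natrD pnatr_eq0.
  rewrite [leRHS]mulrA [leRHS]mulrC.
  exact: ler_wpM2l n12 _ _ (inv_ln_telescope N).
Qed.

End Summation.

(** * From block bounds to partial sum bounds *)

Section FactorialScales.
Context {R : realType}.
Implicit Types (a : nat -> R) (C D : R).

(** The first N %/ Q blocks contribute at most D each, the incomplete last one at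
    most its length. *)
Lemma series_bound_of_blocks a D Q N : (0 < Q)%N ->
    (forall n, `|a n| <= 1) -> (forall m, `|\sum_(n < Q) a (m + n)%N| <= D) ->
  `|series a N| <= D * (N%:R / Q%:R) + Q%:R.
Proof.
move=> Q0 a1 aD.
have D0 : 0 <= D by apply: le_trans (normr_ge0 _) (aD 0%N).
have full b : `|series a (b * Q)%N| <= D * b%:R.
  elim: b => [|b IH].
    by rewrite mul0n /series /= big_geq // normr0 mulr0.
  rewrite /series /= (@big_cat_nat _ _ _ (b * Q)%N) //=; last first.
    by rewrite leq_mul2r leqnSn orbT.
  apply: le_trans (ler_normD _ _) _; rewrite -natr1 mulrDr mulr1.
  apply: lerD; first exact: IH.
  rewrite mulSn -{1}[(b * Q)%N]add0n big_addn addnK big_mkord.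
  by under eq_bigr do rewrite addnC.
have NE := divn_eq N Q.
have lt_r : (N %% Q < Q)%N by rewrite ltn_mod.
rewrite /series /= (@big_cat_nat _ _ _ (N %/ Q * Q)%N) //=; last first.
  exact: leq_trunc_div.
apply: le_trans (ler_normD _ _) _; apply: lerD.
  apply: le_trans (full _) _; apply: ler_wpM2l => //.
  by rewrite ler_pdivlMr ?ltr0n // -natrM ler_nat leq_trunc_div.
apply: le_trans (ler_norm_sum _ _ _) _.
apply: (@le_trans _ _ (\sum_(N %/ Q * Q <= i < N) 1)).
  by apply: ler_sum => i _.
rewrite big_const_nat iter_addr addr0 -mulr_natr mul1r ler_nat.
by rewrite {1}NE addKn ltnW.
Qed.

(** Induction works from the shift 9 on, because (1 + 1/y)^6 <= 2 for y >= 9; it is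
    checked through (1 + 1/y)^2 <= 5/4 and (5/4)^3 <= 2. *)
Lemma sixth_power_le_exp :
  exists E : nat, forall x, ((x + 9) ^ 6 <= E * 2 ^ x)%N.
Proof.
have [E E0] : exists E, (9 ^ 6 <= E)%N by exists (9 ^ 6)%N; exact: leqnn.
exists E; elim=> [|x IH]; first by rewrite muln1.
rewrite (expnS 2) mulnCA; apply: leq_trans (leq_mul (leqnn 2) IH).
rewrite -(leq_pmul2l (_ : 0 < 64)%N) //.
have : (4 * (x.+1 + 9) ^ 2 <= 5 * (x + 9) ^ 2)%N by rewrite !expnS !expn0; nia.
rewrite -(leq_exp2r _ _ (_ : 0 < 3)%N) // (expnMn 4) (expnMn 5) -!expnM => h.
by apply: (leq_trans h); rewrite mulnA leq_mul2r orbT.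
Qed.

(** With x = j!, (j+2)! + 1 is at most (x + 9)^3, so its square is polynomial
    in x. *)
Lemma factorial_sq_le_exp :
  exists E : nat, forall j, (((j.+2)`!.+1) ^ 2 <= E * 2 ^ (j`!))%N.
Proof.
have [E hE] := sixth_power_le_exp; exists E => j; apply: leq_trans (hE _).
have jf : (j <= j`!)%N by elim: j => // j IH; rewrite factS; have := fact_gt0 j; nia.
rewrite (_ : 6 = 3 * 2)%N // (expnM _ 3) leq_exp2r // !factS.
move: (j`!) jf => x jx; rewrite !expnS expn0 muln1; nia.
Qed.

Lemma exists_factorial_scale (K N : nat) : (2 ^ (K.+1)`! <= N)%N ->
  exists2 j, (K <= j)%N & (2 ^ (j.+1)`! <= N < 2 ^ (j.+2)`!)%N.
Proof.
move=> KN; pose P j := (K <= j)%N && (2 ^ (j.+1)`! <= N)%N.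
have exP : exists j, P j by exists K; rewrite /P leqnn.
have ubP j : P j -> (j <= N)%N.
  move=> /andP[_ jN]; apply: leq_trans jN.
  apply: leq_trans (ltnW (ltn_expl _ (_ : 1 < 2)%N)) => //.
  by rewrite factS; have := fact_gt0 j; nia.
case: (ex_maxnP exP ubP) => j /andP[Kj jN] jmax; exists j => //.
rewrite jN ltnNge; apply/negP => j1N.
have /jmax : P j.+1 by rewrite /P j1N leqW.
by rewrite ltnn.
Qed.

Lemma ln_pow2_le (m : nat) : ln (2 ^+ m : R) <= m%:R.
Proof.
rewrite lnXn // -[leLHS]mulr_natl ler_piMr //.
by have := @le_ln1Dx R 1; rewrite -[1 + 1]/(2 : R); apply; lra.
Qed.

(** For 2^(j+1)! <= N < 2^(j+2)!, blocks two factorials below N, of length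
    Q = 2^j!, are still good enough: Q^2 <= N makes the incomplete block
    negligible, and ln^2 N = O(Q) makes N / Q acceptable.  Using them instead of
    the longest possible blocks needs one block length only.  Small N are absorbed
    in the constant. *)
Lemma partial_sum_bound_of_factorial_blocks a D K :
    (forall n, `|a n| <= 1) ->
    (forall j m, (K <= j)%N -> `|\sum_(n < 2 ^ j`!) a (m + n)%N| <= D) ->
  exists C, forall N, `|series a N| <= C * N%:R / ln (N.+2%:R) ^+ 2.
Proof.
move=> a1 aD; pose K' := maxn K 1; pose B : nat := (2 ^ (K'.+1)`!)%N.
have [E hE] := factorial_sq_le_exp.
have D0 : 0 <= D by apply: le_trans (normr_ge0 _) (aD K 0%N (leqnn _)).
have lnp n : 0 < ln (n.+2%:R : R) by apply: ln_gt0; rewrite ltr1n.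
have lnp2 n : 0 < ln (n.+2%:R : R) ^+ 2 by rewrite exprn_gt0.
pose C := Num.max (ln (B.+2%:R : R) ^+ 2) ((D + 1) * E%:R).
exists C => N; have [BN|NB] := leqP B N; last first.
  rewrite mulrAC; apply: (@le_trans _ _ N%:R).
    rewrite /series /=; apply: le_trans (ler_norm_sum _ _ _) _.
    apply: (@le_trans _ _ (\sum_(0 <= i < N) 1)).
      by apply: ler_sum => i _.
    by rewrite big_const_nat iter_addr addr0 subn0.
  apply: ler_peMl => //; rewrite ler_pdivlMr // mul1r.
  apply: (@le_trans _ _ (ln (B.+2%:R) ^+ 2)); last by rewrite le_max lexx.
  by rewrite ler_pXn2r ?nnegrE ?(ltW (lnp _)) // ler_ln ?posrE // ler_nat !ltnS ltnW.
have [j Kj /andP[jN Nj]] := exists_factorial_scale _ _ BN.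
have j1 : (1 <= j)%N by apply: leq_trans Kj; rewrite leq_maxr.
have {}Kj : (K <= j)%N by apply: leq_trans Kj; rewrite leq_maxl.
pose Q := (2 ^ j`!)%N.
have Q0 : (0 < Q)%N by rewrite expn_gt0.
have Q0' : 0 < Q%:R :> R by rewrite ltr0n.
apply: le_trans (series_bound_of_blocks _ _ _ N Q0 a1 (fun m => aD j m Kj)) _.
have QN : Q%:R <= N%:R / Q%:R :> R.
  rewrite ler_pdivlMr // -natrM ler_nat; apply: leq_trans jN.
  by rewrite -expnD leq_exp2l // addnn -mul2n factS leq_mul2r ltnS j1 orbT.
have Lj : ln (N.+2%:R : R) <= ((j.+2)`!.+1)%:R.
  apply: le_trans (ln_pow2_le _).
  rewrite ler_ln ?posrE ?exprn_gt0 // -natrX ler_nat expnS.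
  have : (2 <= N)%N.
    apply: leq_trans jN; rewrite -{1}(expn1 2) leq_exp2l //.
    exact: fact_gt0.
  by lia.
have LQ : ln (N.+2%:R : R) ^+ 2 <= E%:R * Q%:R.
  apply: (@le_trans _ _ (((j.+2)`!.+1)%:R ^+ 2)).
    by rewrite ler_pXn2r ?nnegrE ?(ltW (lnp _)).
  by rewrite -natrX -natrM ler_nat hE.
apply: (@le_trans _ _ ((D + 1) * (N%:R / Q%:R))).
  by rewrite mulrDl mul1r lerD2l.
apply: (@le_trans _ _ ((D + 1) * E%:R * N%:R / ln (N.+2%:R) ^+ 2)).
  rewrite -!mulrA; apply: ler_wpM2l; first by rewrite addr_ge0.
  rewrite mulrCA; apply: ler_wpM2l => //.
  by rewrite ler_pdivlMr // mulrC ler_pdivrMr.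
rewrite ler_pM2r ?invr_gt0 //; apply: ler_wpM2r => //.
by rewrite le_max lexx orbT.
Qed.

End FactorialScales.

(** * Numbers approximated at the factorial powers of two *)

Section LiouvilleNumbers.
Context {R : realType}.
Implicit Types (alpha : R).

Definition factorial_denom (k : nat) : nat := (2 ^ k`!)%N.

(** With Q = 2^k! and Q' = 2^(k+1)!, the inequalities say that alpha - P / Q is
    positive and at most 2 / Q'.  The approximation from below is what allows the
    drift of the orbit in one period to have a constant sign. *)
Definition factorially_approximable alpha (K : nat) := forall k, (K <= k)%N ->
  exists P : int, [/\ coprimez (factorial_denom k) P,
    P%:~R < (factorial_denom k)%:R * alpha &
    (factorial_denom k.+1)%:R * ((factorial_denom k)%:R * alpha - P%:~R)
      <= 2 * (factorial_denom k)%:R].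

Lemma factorial_denom_gt0 k : (0 < factorial_denom k)%N.
Proof. by rewrite expn_gt0. Qed.

Lemma factorial_denomS k :
  factorial_denom k.+1 = (factorial_denom k ^ k.+1)%N.
Proof. by rewrite /factorial_denom factS mulnC expnM. Qed.

Lemma ltn_factorial_denom k : (k < factorial_denom k)%N.
Proof.
apply: leq_ltn_trans (ltn_expl _ (_ : 1 < 2)%N) => //.
by elim: k => // k IH; rewrite factS; have := fact_gt0 k; nia.
Qed.

Lemma factorial_denomS_ge k : (2 <= k)%N ->
  (4 * factorial_denom k ^ 2 <= factorial_denom k.+1)%N.
Proof.
move=> k2; have Q3 := leq_ltn_trans k2 (ltn_factorial_denom k).
have Q4 : (4 <= factorial_denom k)%N.
  by rewrite -[4%N]/(2 ^ 2)%N leq_exp2l //; case: k k2 {Q3} => [|[|k]] // _;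
    rewrite !factS; have := fact_gt0 k; nia.
rewrite factorial_denomS; apply: (@leq_trans (factorial_denom k ^ 3)).
  by rewrite (expnS _ 2) leq_mul2r Q4 orbT.
by rewrite leq_exp2l // ltnW // ltnW.
Qed.

Lemma scaled_approximation_error alpha (Q Q' : nat) (p : R) : (0 < Q)%N ->
    (4 * Q ^ 2 <= Q')%N -> p < Q%:R * alpha ->
    Q'%:R * (Q%:R * alpha - p) <= 2 * Q%:R ->
  2 * Q%:R * (Q%:R * alpha - p) <= 1.
Proof.
move=> Q0 QQ' d0 dQ; have Q0' : 0 < Q%:R :> R by rewrite ltr0n.
have Q4 : 4 * Q%:R ^+ 2 <= Q'%:R :> R by rewrite -natrX -natrM ler_nat.
rewrite -subr_gt0 in d0; move: (Q%:R * alpha - p) (Q'%:R : R) dQ Q4 d0.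
move=> d q' dq' Q4 d0; rewrite -(ler_pM2l (_ : 0 < 2 * Q%:R)) ?mulr_gt0 //.
rewrite mulr1; apply: le_trans dq'.
have -> : 2 * Q%:R * (2 * Q%:R * d) = 4 * Q%:R ^+ 2 * d :> R by ring.
by rewrite ler_pM2r.
Qed.

(** If b is the denominator of alpha, then b (Q alpha - P) is a positive integer,
    hence at least 1, while Q alpha - P <= 1 / (2 Q): impossible once Q > b. *)
Lemma irrational_of_factorial_approximation alpha K :
  factorially_approximable alpha K -> irrational alpha.
Proof.
move=> fa; rewrite irrationalE => q _ /= [_ -> qE].
pose k := maxn (maxn K 2) `|denq q|%N.
have kK : (K <= k)%N by rewrite !leq_max leqnn.
have k2 : (2 <= k)%N by rewrite !leq_max leqnn orbT.
have [P [_ d0 dQ]] := fa k kK.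
have := scaled_approximation_error _ _ _ _ (factorial_denom_gt0 k)
  (factorial_denomS_ge _ k2) d0 dQ.
have b0 : 0 < (denq q)%:~R :> R by rewrite ltr0z.
have bk : (denq q)%:~R < (factorial_denom k)%:R :> R.
  rewrite -[(denq q)]gez0_abs // ltr_nat.
  by apply: leq_ltn_trans (ltn_factorial_denom k); rewrite !leq_max leqnn orbT.
have dI : (denq q)%:~R * ((factorial_denom k)%:R * alpha - P%:~R) =
    ((factorial_denom k)%:Z * numq q - denq q * P)%:~R.
  rewrite -qE /ratr intrB !intrM mulrBr mulrCA; congr (_ * _ - _).
  by rewrite mulrC divfK // gt_eqF.
move: d0; rewrite -subr_gt0 => d0.
have d1 : 1 <= (denq q)%:~R * ((factorial_denom k)%:R * alpha - P%:~R).
  move: (mulr_gt0 b0 d0); rewrite dI ltr0z => gt0.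
  by rewrite -[1]/(1%:~R) ler_int -gtz0_ge1.
move: d0 d1 bk; move: ((factorial_denom k)%:R * alpha - P%:~R) => d.
move=> d0 d1 bk; have := bk; rewrite -(ltr_pM2r d0); lra.
Qed.

(** As 2^(k+1)! is the (k+1)-st power of Q = 2^k!, the error 2 / Q^(k+1) is below
    Q^-(v+1) when k exceeds v by enough. *)
Lemma liouville_of_factorial_approximation alpha K :
  factorially_approximable alpha K -> liouville alpha.
Proof.
move=> fa; split; first exact: irrational_of_factorial_approximation fa.
move=> v v1; pose m := (Num.truncn v).+1; have vm := truncnS_gt v.
rewrite -/m in vm; pose k := maxn (maxn K 2) m.+2.
have kK : (K <= k)%N by rewrite !leq_max leqnn.
have k2 : (2 <= k)%N by rewrite !leq_max leqnn orbT.
have km : (m.+2 <= k)%N by rewrite !leq_max leqnn orbT.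
have [P [_ d0 dQ]] := fa k kK.
pose Q := factorial_denom k.
have Q3 : (3 <= Q)%N := leq_ltn_trans k2 (ltn_factorial_denom k).
have Q0 : 0 < Q%:R :> R by rewrite ltr0n; apply: ltnW (ltnW Q3).
exists P, Q%:Z; split; first by rewrite lez_nat ltnW.
have -> : (Q%:Z%:~R : R) = Q%:R by [].
have QQ : 2 * Q%:R ^+ m.+1 < (factorial_denom k.+1)%:R :> R.
  rewrite -natrX -natrM ltr_nat factorial_denomS -/Q.
  apply: (@leq_trans (Q ^ m.+2)); last first.
    by rewrite leq_exp2l ?(ltnW Q3) // ltnW // ltnW.
  by rewrite [X in (_ < X)%N]expnS ltn_pmul2r ?expn_gt0 ?(ltnW (ltnW Q3)).
apply: (@lt_le_trans _ _ ((Q%:R ^+ m.+1)^-1)); last first.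
  rewrite powRN lef_pV2 ?posrE ?powR_gt0 ?exprn_gt0 //.
  rewrite -powR_mulrn ?(ltW Q0) //; apply: ler_powR.
    by rewrite (ler_nat _ 1) (ltnW (ltnW Q3)).
  by rewrite -natr1 lerD2r ltW.
have -> : alpha - P%:~R / Q%:R = (Q%:R * alpha - P%:~R) / Q%:R.
  by rewrite mulrBl mulrAC divff ?gt_eqF // mul1r.
rewrite -/Q -subr_gt0 in d0; rewrite -/Q in dQ.
rewrite normrM normfV !gtr0_norm // ltr_pdivrMr //.
rewrite ltr_pdivlMl ?exprn_gt0 //.
move: d0 dQ QQ; move: (Q%:R * alpha - P%:~R) ((factorial_denom k.+1)%:R : R).
move=> d q' d0 dQ QQ; have X0 : 0 < Q%:R ^+ m.+1 :> R by rewrite exprn_gt0.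
have := ltr_pM2r d0; nra.
Qed.

End LiouvilleNumbers.

(** * Convergence, construction and density *)

Section Conclusion.
Context {R : realType}.
Implicit Types (alpha : R).

Lemma measurable_preimage_union k (I : 'I_k -> set (circle R)) :
  (forall j, circle_interval (I j)) ->
  measurable (circle_proj @^-1` (\bigcup_j I j)).
Proof.
move=> iI; rewrite preimage_bigcup; apply: countable_bigcupT_measurable.
  exact: countableP.
by move=> j; exact: measurable_preimage_circle_interval.
Qed.

(** The sum of f over a block is twice the deviation bounded by [block_count],
    because Q m(U) = Q / 2 there. *)
Lemma balanced_series_of_factorial_approximation alpha K :
  factorially_approximable alpha K -> balanced_series_property alpha.
Proof.
move=> fa U [k [I [iI ->{U}]]]; set U := \bigcup_j I j => mU x.
have [y <-{x}] := circle_proj_surj x.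
set V := circle_proj @^-1` U.
have mV : measurable V by exact: measurable_preimage_union.
have pV t (z : int) : V (t + z%:~R) -> V t.
  rewrite /V /=; suff -> : circle_proj (t + z%:~R) = circle_proj t by [].
  by apply/circle_proj_eq; exists z.
pose a (i : nat) : R := 2 * \1_V (y + i.+1%:R * alpha) - 1.
have bE i : balanced U (circle_proj y + circle_proj (i.+1%:R * alpha)) = a i.
  by rewrite -circle_projD.
have a1 i : `|a i| <= 1.
  by rewrite /a indicE ler_norml; case: (_ \in _) => /=; apply/andP; split; lra.
have aD j m : (maxn K 2 <= j)%N ->
    `|\sum_(n < 2 ^ j`!) a (m + n)%N| <= 2 * (4 * k)%:R.
  rewrite geq_max => /andP[Kj j2].
  have [P [cP Pa dQ]] := fa j Kj.
  have err := scaled_approximation_error _ _ _ _ (factorial_denom_gt0 j)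
    (factorial_denomS_ge _ j2) Pa dQ.
  have d0 := Pa; rewrite -subr_gt0 in d0.
  have QdS : (factorial_denom j)%:R *
      ((factorial_denom j)%:R * alpha - P%:~R) < 1.
    by move: err; rewrite -mulrA; nra.
  have := block_count _ V P alpha (y + m.+1%:R * alpha)
    (factorial_denom_gt0 j) mV pV cP (ltW Pa) QdS.
  rewrite [lebesgue_measure _]mU /= -/(factorial_denom j).
  set s := (X in `|X - _| <= _) => sC.
  have -> : \sum_(n < factorial_denom j) a (m + n)%N =
      2 * (s - (factorial_denom j)%:R * 2^-1).
    rewrite /a sumrB -mulr_sumr sumr_const card_ord mulrBr; congr (_ * _ - _).
      apply: eq_bigr => n _; congr (\1_V _); rewrite -addrA -mulrDl -natrD.
      by rewrite addSn.
    by rewrite mulrCA divff // mulr1.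
  rewrite normrM ger0_norm // ler_pM2l //; apply: le_trans sC _.
  by rewrite ler_nat card_windows_split_by_union // factorial_denom_gt0.
have [C hC] := partial_sum_bound_of_factorial_blocks _ _ _ a1 aD.
rewrite /series_converges.
under eq_fun do rewrite big_add1 /=.
under eq_fun do under eq_bigr do rewrite bE.
exact: cvg_series_of_partial_sum_bound hC.
Qed.

(** The numerators of the partial sums a / 2^m! + 2^-(m+1)! + ... + 2^-(m+i)!;
    the factor is the quotient of two consecutive denominators. *)
Fixpoint numerator (m a i : nat) : nat :=
  if i is i'.+1 then
    numerator m a i' * factorial_denom (m + i') ^ (m + i') + 1
  else a.

(** alpha is the sum of the series with partial sums u.  The tail after u i is
    less than twice its first term, so u i and v i := u i + 2 / 2^(m+i+1)!
    enclose alpha, the former increasing and the latter decreasing.  Every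
    numerator but the first is odd, hence coprime to the power of two below it. *)
Lemma factorially_approximable_in_cell (m a : nat) : (2 <= m)%N ->
  exists2 alpha : R, factorially_approximable alpha m.+1 &
    a%:R < (factorial_denom m)%:R * alpha < a.+1%:R.
Proof.
move=> m2; pose Q i : R := (factorial_denom (m + i))%:R.
have Q0 i : 0 < Q i by rewrite ltr0n factorial_denom_gt0.
have Qn0 i : Q i != 0 by rewrite gt_eqF.
pose u i : R := (numerator m a i)%:R / Q i.
have uS i : u i.+1 = u i + (Q i.+1)^-1.
  rewrite /u /=; apply: (mulIf (Qn0 i.+1)).
  rewrite divfK ?gt_eqF // mulrDl mulVf ?gt_eqF // natrD natrM natrX.
  congr (_ + _); rewrite -mulrA; congr (_ * _).
  rewrite /Q addnS factorial_denomS natrX exprS mulKf //.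
  exact: Qn0.
have QS i : 4 * Q i ^+ 2 <= Q i.+1.
  rewrite /Q -natrX -natrM ler_nat addnS factorial_denomS_ge //.
  by rewrite (leq_trans m2) // leq_addr.
have Q1 i : 1 <= Q i by rewrite (ler_nat _ 1) factorial_denom_gt0.
have Q4 i : 4 * (Q i.+1)^-1 <= (Q i)^-1.
  rewrite ler_pdivrMr // mulrC ler_pdivlMr //; apply: le_trans (QS i).
  by have := Q1 i; nra.
pose v i : R := u i + 2 * (Q i.+1)^-1.
have Qi i : 0 < (Q i)^-1 by rewrite invr_gt0.
have vS i : v i.+1 <= v i.
  by rewrite /v uS; have := Q4 i.+1; have := Qi i.+1; have := Qi i.+2; lra.
have u_nd : {homo u : i j / (i <= j)%N >-> i <= j}.
  by apply/nondecreasing_seqP => i; rewrite uS lerDl ltW.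
have v_ni : {homo v : i j / (i <= j)%N >-> j <= i}.
  by apply/nonincreasing_seqP.
have uv i j : u i <= v j.
  apply: (@le_trans _ _ (u (maxn i j))); first by rewrite u_nd ?leq_maxl.
  apply: (@le_trans _ _ (v (maxn i j))); last by rewrite v_ni ?leq_maxr.
  by rewrite lerDl mulr_ge0 // ltW.
pose alpha := sup (range u).
have alpha_le i : alpha <= v i.
  by apply: ge_sup; [exists (u 0%N), 0%N | move=> _ [j _ <-]].
have lt_alpha i : u i < alpha.
  apply: (@lt_le_trans _ _ (u i.+1)); first by rewrite uS ltrDl.
  by apply: ub_le_sup; [exists (v 0%N) => _ [j _ <-] | exists i.+1].
have Qu i : Q i * u i = (numerator m a i)%:R.
  by rewrite /u mulrC divfK // gt_eqF.
have numE i : (numerator m a i)%:Z%:~R = Q i * u i by rewrite Qu.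
exists alpha.
- move=> k mk; have [i kE] : exists i, k = (m + i.+1)%N.
    by exists (k - m.+1)%N; rewrite addnS -addSn subnKC.
  exists (numerator m a i.+1); split.
  + rewrite kE coprimezE /= /factorial_denom coprimeXl // coprime2n.
    rewrite oddD oddM oddX /factorial_denom oddX /=.
    rewrite [(m + i)%N == 0%N]gtn_eqF; last by rewrite addn_gt0 (ltnW m2).
    by rewrite (gtn_eqF (fact_gt0 _)) andbF.
  + by rewrite numE kE -/(Q i.+1) ltr_pM2l.
  + rewrite numE kE -addnS -/(Q i.+1) -/(Q i.+2) -mulrBr mulrCA.
    rewrite [leRHS]mulrC ler_pM2l // mulrC -ler_pdivlMr // lerBlDl.
    exact: alpha_le.
- have QE : (factorial_denom m)%:R = Q 0%N by rewrite /Q addn0.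
  rewrite QE -[a%:R]/((numerator m a 0)%:R) -Qu ltr_pM2l // lt_alpha /=.
  rewrite mulrC -ltr_pdivlMr // -natr1 mulrDl mul1r.
  apply: le_lt_trans (alpha_le 0%N) _; rewrite ltrD2l.
  by have := Q4 0%N; have := Qi 1%N; lra.
Qed.

(** The cell of length 2^-m! containing x also contains a suitable alpha, and it is
    contained in [0, 1]. *)
Lemma factorially_approximable_dense (x e : R) : 0 < x < 1 -> 0 < e ->
  exists alpha, [/\ 0 < alpha < 1, `|x - alpha| < e
    & exists K, factorially_approximable alpha K].
Proof.
move=> /andP[x0 x1] e0; pose m := (Num.truncn e^-1).+2.
have Q0 : 0 < (factorial_denom m)%:R :> R by rewrite ltr0n factorial_denom_gt0.
have Qe : 1 < (factorial_denom m)%:R * e.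
  rewrite -ltr_pdivrMr // div1r; apply: lt_trans (truncnS_gt _) _.
  by rewrite ltr_nat; apply: leq_trans (ltn_factorial_denom _).
pose a := Num.truncn ((factorial_denom m)%:R * x).
have /andP[ax xa] : a%:R <= (factorial_denom m)%:R * x < a.+1%:R.
  by apply: truncn_itv; rewrite mulr_ge0 // ltW.
have aQ : a.+1%:R <= (factorial_denom m)%:R :> R.
  by rewrite ler_nat -(ltr_nat R); apply: le_lt_trans ax _; rewrite gtr_pMr.
have [alpha fa /andP[aal ala]] :=
  factorially_approximable_in_cell m a (isT : 2 <= m)%N.
exists alpha; split; last by exists m.+1.
- apply/andP; split; rewrite -(ltr_pM2l Q0).
    by rewrite mulr0; apply: le_lt_trans aal.
  by rewrite mulr1; apply: lt_le_trans aQ.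
- rewrite -(ltr_pM2l Q0); apply: lt_trans Qe.
  rewrite -[X in X * _](gtr0_norm Q0) -normrM mulrBr ltr_norml.
  by rewrite -natr1 in xa ala; apply/andP; split; lra.
Qed.

End Conclusion.

Theorem theorem3 (R : realType) :
  (exists alpha : R,
     [/\ 0 < alpha < 1, liouville alpha & balanced_series_property alpha]) /\
  `]0, 1[ `<=` closure [set alpha : R |
     [/\ 0 < alpha < 1, liouville alpha & balanced_series_property alpha]].
Proof.
have near (x e : R) : 0 < x < 1 -> 0 < e -> exists2 alpha, `|x - alpha| < e &
    [/\ 0 < alpha < 1, liouville alpha & balanced_series_property alpha].
  move=> x01 e0.
  have [alpha [al01 xal [K fa]]] := factorially_approximable_dense _ _ x01 e0.
  exists alpha => //; split=> //.
    exact: liouville_of_factorial_approximation fa.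
  exact: balanced_series_of_factorial_approximation fa.
split.
  have half : 0 < (2^-1 : R) < 1 by apply/andP; split; lra.
  by have [alpha _ good] := near _ _ half ltr01; exists alpha.
move=> x; rewrite /= in_itv /= => x01 B /nbhs_ballP[e /= e0 eB].
have [alpha xal good] := near _ _ x01 e0.
by exists alpha; split=> //; apply: eB.
Qed.
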